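(* The set $$G=\{L_\upsilon R_\chi F^\nu:\ \upsilon,\chi\in\operatorname{Aut}\mathbb{D},\ \nu=0\text{ or }1\}$$ is a group (under composition) of automorphisms of $\mathbb{E}$.
   Context: $\mathbb{D}$ is the open unit disc, $\mathbb{T}$ the unit circle. The tetrablock is $\mathbb{E}=\{x\in\mathbb{C}^3: 1-x_1z-x_2w+x_3zw\ne0 \text{ whenever } |z|\le1,\ |w|\le1\}$. An automorphism of a domain is a biholomorphic self-map; $\operatorname{Aut}$ denotes the automorphism group. For $x,y\in\mathbb{C}^3$ with $x_2y_1\ne1$ define $$x\diamond y=\frac{1}{1-x_2y_1}\,(x_1-x_3y_1,\ y_2-x_2y_3,\ x_1y_2-x_3y_3).$$ Every $\upsilon\in\operatorname{Aut}\mathbb{D}$ is uniquely of the form $\upsilon(z)=\omega\dfrac{z-\alpha}{\bar\alpha z-1}$ with $\alpha\in\mathbb{D}$, $\omega\in\mathbb{T}$; put $\tau(\upsilon)=(\omega\alpha,\bar\alpha,\omega)$. For $\upsilon,\chi\in\operatorname{Aut}\mathbb{D}$ and $x\in\mathbb{E}$ define $L_\upsilon(x)=\tau(\upsilon)\diamond x$ and $R_\chi(x)=x\diamond\tau(\chi)$. The flip is $F(x_1,x_2,x_3)=(x_2,x_1,x_3)$, and $F^0$ is the identity. *)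

(* Defs.v *)
From HB Require Import structures.
From mathcomp Require Import all_boot all_order all_algebra.
From mathcomp Require Import all_classical all_reals all_analysis.
From mathcomp.real_closed Require Import complex.

Set Implicit Arguments.
Unset Strict Implicit.
Unset Printing Implicit Defensive.

Import Order.TTheory GRing.Theory Num.Theory.
Import numFieldNormedType.Exports.

Local Open Scope classical_set_scope.
Local Open Scope ring_scope.

Section Automorphisms.
Context {R : realType} {V : normedModType R[i]}.
Implicit Types (D : set V) (f g : V -> V).

(* [differentiable] is Frechet differentiability over the field R[i], i.e.
   complex differentiability.  The values of [f] outside [D] are irrelevant
   when [D] is open. *)
Definition holomorphic_on D f := forall x, D x -> differentiable f x.

(* Biholomorphic self-maps of the domain [D], represented by functions on the
   ambient space; only their values on [D] are meaningful. *)
Definition Aut D : set (V -> V) :=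
  [set f | (forall x, D x -> D (f x)) /\ holomorphic_on D f /\
    exists g, [/\ forall x, D x -> D (g x), holomorphic_on D g,
      forall x, D x -> g (f x) = x & forall x, D x -> f (g x) = x]].

(* Equations between self-maps of [D] are required on [D] only. *)
Definition is_automorphism_group D (G : set (V -> V)) :=
  [/\ G `<=` Aut D,
      exists2 e, G e & forall x, D x -> e x = x,
      forall f g, G f -> G g -> G (f \o g) &
      forall f, G f -> exists2 g, G g &
        forall x, D x -> g (f x) = x /\ f (g x) = x].

End Automorphisms.

Section Tetrablock.
Variable R : realType.
Local Notation C := R[i].
Local Notation C3 := 'rV[R[i]]_3.

Definition vec3 (a b c : C) : C3 := \row_(j < 3) nth 0 [:: a; b; c] j.

Definition crd1 (x : C3) : C := x 0 0.
Definition crd2 (x : C3) : C := x 0 1.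
Definition crd3 (x : C3) : C := x 0 2%:R.

Lemma crd1_vec3 a b c : crd1 (vec3 a b c) = a. Proof. by rewrite /crd1 mxE. Qed.
Lemma crd2_vec3 a b c : crd2 (vec3 a b c) = b. Proof. by rewrite /crd2 mxE. Qed.
Lemma crd3_vec3 a b c : crd3 (vec3 a b c) = c. Proof. by rewrite /crd3 mxE. Qed.

(* [C^o] is the field [C] as a normed space over itself. *)
Definition unit_disc : set C^o := [set z : C | `|z| < 1].

Definition tetrablock : set C3 :=
  [set x | forall z w : C, `|z| <= 1 -> `|w| <= 1 ->
    1 - crd1 x * z - crd2 x * w + crd3 x * z * w != 0].

(* Meaningful for [crd2 x * crd1 y != 1]; otherwise division by zero makes the
   value 0.  See [diamond_defined_l] and
   [diamond_defined_r]. *)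
Definition diamond (x y : C3) : C3 :=
  (1 - crd2 x * crd1 y)^-1 *:
  vec3 (crd1 x - crd3 x * crd1 y)
       (crd2 y - crd2 x * crd3 y)
       (crd1 x * crd2 y - crd3 x * crd3 y).

(* Graph of tau: [t] is the parameter vector of [upsilon].  The graph is
   single-valued by [is_tau_unique], and every automorphism of the disc has a
   parameter vector by the classical description of these automorphisms. *)
Definition is_tau (upsilon : C^o -> C^o) (t : C3) :=
  exists alpha omega : C, [/\ `|alpha| < 1, `|omega| = 1,
    forall z : C, `|z| < 1 ->
      upsilon z = omega * ((z - alpha) / (alpha^* * z - 1)) &
    t = vec3 (omega * alpha) alpha^* omega].

(* [l] represents the map L_upsilon (resp. [r] the map R_chi), whose domain is
   the tetrablock. *)
Definition is_L (upsilon : C^o -> C^o) (l : C3 -> C3) :=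
  exists2 t, is_tau upsilon t & forall x, tetrablock x -> l x = diamond t x.

Definition is_R (chi : C^o -> C^o) (r : C3 -> C3) :=
  exists2 t, is_tau chi t & forall x, tetrablock x -> r x = diamond x t.

Definition flip (x : C3) : C3 := vec3 (crd2 x) (crd1 x) (crd3 x).

(* The set of all L_upsilon R_chi F^nu; membership only depends on the values
   on the tetrablock. *)
Definition LRF_maps : set (C3 -> C3) :=
  [set f | exists upsilon chi : C^o -> C^o, exists nu : nat,
    [/\ Aut unit_disc upsilon, Aut unit_disc chi, nu = 0%N \/ nu = 1%N &
      exists l r : C3 -> C3, [/\ is_L upsilon l, is_R chi r &
        forall x, tetrablock x -> f x = l (r (iter nu flip x))]]].

Lemma mobius_denom_neq0 (alpha z : C) :
  `|alpha| < 1 -> `|z| < 1 -> alpha^* * z - 1 != 0.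
Proof.
move=> ha hz; rewrite subr_eq0; apply/eqP => h.
have : `|alpha^* * z| < 1 by rewrite normrM norm_conjC mulr_ilt1 ?normr_ge0.
by rewrite h normr1 ltxx.
Qed.

Lemma is_tau_unique (upsilon : C^o -> C^o) (s t : C3) :
  is_tau upsilon s -> is_tau upsilon t -> s = t.
Proof.
move=> [a [u [ha ho hu ->]]] [b [p [hb hp hv ->]]].
have u0 : u != 0 by rewrite -normr_eq0 ho oner_eq0.
have p0 : p != 0 by rewrite -normr_eq0 hp oner_eq0.
have ab : a = b.
  have := hv a ha; rewrite hu // subrr mul0r mulr0 => /esym/eqP.
  rewrite !mulf_eq0 invr_eq0 (negPf p0) (negPf (mobius_denom_neq0 hb ha)) orbF /=.
  by rewrite subr_eq0 => /eqP.
subst b; suff -> : u = p by [].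
have [a0 | a1] := eqVneq a 0.
  have h2 : `|2^-1 : C| < 1 by rewrite ger0_norm ?invr_ge0 ?invf_lt1 ?ltr1n.
  have := hv _ h2; rewrite hu // => /mulIf; apply.
  by rewrite mulf_neq0 ?invr_eq0 ?mobius_denom_neq0 // a0 subr0 invr_eq0 pnatr_eq0.
have h0 : `|0 : C| < 1 by rewrite normr0.
have := hv _ h0; rewrite hu // => /mulIf; apply.
by rewrite mulf_neq0 ?invr_eq0 ?mobius_denom_neq0 // sub0r oppr_eq0.
Qed.

Lemma diamond_defined_l upsilon t x :
  is_tau upsilon t -> tetrablock x -> crd2 t * crd1 x != 1.
Proof.
move=> [a [u [ha ho _ ->]]] hx; rewrite crd2_vec3.
have := hx a^* 0; rewrite norm_conjC normr0 ler01 ltW // => /(_ isT isT).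
by rewrite !mulr0 subr0 addr0 subr_eq0 eq_sym mulrC.
Qed.

Lemma diamond_defined_r chi t x :
  is_tau chi t -> tetrablock x -> crd2 x * crd1 t != 1.
Proof.
move=> [a [u [ha ho _ ->]]] hx; rewrite crd1_vec3.
have := hx 0 (u * a); rewrite normrM ho mul1r normr0 ler01 ltW // => /(_ isT isT).
by rewrite !mulr0 mul0r subr0 addr0 subr_eq0 eq_sym.
Qed.

End Tetrablock.

Arguments tetrablock : clear implicits.
Arguments LRF_maps : clear implicits.
Arguments unit_disc : clear implicits.

(* Main.v *)
(* Send x in C^3 to the matrix M_x with rows (x_3, -x_1) and (x_2, -1).  Then
   M_x M_y = -(1 - x_2 y_1) M_{x <> y}, so <> is matrix multiplication up to
   scalars, M_{tau(upsilon)} acts as the Moebius map upsilon, and x lies in the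
   tetrablock iff M_x maps the closed disc into the open disc.  Hence L and R
   preserve the tetrablock, and products and inverses of the tau's are again
   tau's.  The flip is, up to conjugation by diag(1, -1), the transposition; so
   it exchanges the two factors of a product, which gives
   F L_s = R_{F s} F and closes the set under composition and inversion.
   Complex differentiability only depends on the values near a point, so it
   requires the tetrablock to be open: this follows from the explicit centre and
   radius of the image of the disc under x, which turn membership into one
   strict inequality between continuous functions. *)
Require Import Defs.
From mathcomp Require Import all_boot all_order all_algebra.
From mathcomp Require Import ring.
From mathcomp Require Import all_classical all_reals all_analysis.
From mathcomp.real_closed Require Import complex.
Import numFieldNormedType.Exports.

Set Implicit Arguments.
Unset Strict Implicit.
Unset Printing Implicit Defensive.

Import Order.TTheory GRing.Theory Num.Theory.
Local Open Scope classical_set_scope.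
Local Open Scope ring_scope.

(** * The diamond product and the invariance of the tetrablock *)

Section Algebra.
Variable R : realType.
Local Notation C := R[i].
Local Notation C3 := 'rV[R[i]]_3.
Implicit Types (x y z s t : C3) (a b w : C).

Lemma crd_inj x y :
  crd1 x = crd1 y -> crd2 x = crd2 y -> crd3 x = crd3 y -> x = y.
Proof.
move=> e1 e2 e3; apply/rowP => -[[|[|[|//]]] lt_j3].
- by rewrite (_ : Ordinal _ = 0) //; apply: val_inj.
- by rewrite (_ : Ordinal _ = 1) //; apply: val_inj.
- by rewrite (_ : Ordinal _ = 2%:R) //; apply: val_inj.
Qed.

Lemma crd1_diamond x y : crd1 (diamond x y) =
  (crd1 x - crd3 x * crd1 y) / (1 - crd2 x * crd1 y).
Proof. by rewrite /diamond [LHS]mxE mxE /= mulrC. Qed.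

Lemma crd2_diamond x y : crd2 (diamond x y) =
  (crd2 y - crd2 x * crd3 y) / (1 - crd2 x * crd1 y).
Proof. by rewrite /diamond [LHS]mxE mxE /= mulrC. Qed.

Lemma crd3_diamond x y : crd3 (diamond x y) =
  (crd1 x * crd2 y - crd3 x * crd3 y) / (1 - crd2 x * crd1 y).
Proof. by rewrite /diamond [LHS]mxE mxE /= mulrC. Qed.

Definition crdE := (crd1_vec3, crd2_vec3, crd3_vec3,
  crd1_diamond, crd2_diamond, crd3_diamond).

Lemma flipK : involutive (@flip R).
Proof. by move=> x; apply: crd_inj; rewrite !crdE. Qed.

Lemma flip_diamond x y : flip (diamond x y) = diamond (flip y) (flip x).
Proof.
by apply: crd_inj; rewrite !crdE [crd1 y * crd2 x]mulrC;
   congr (_ / _); ring.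
Qed.

(** Matrix multiplication is associative. Both groupings carry the same total scalar, so the fourth
    denominator, that of [diamond x (diamond y z)], is nonzero too. *)
Lemma diamondA x y z : 1 - crd2 x * crd1 y != 0 -> 1 - crd2 y * crd1 z != 0 ->
  1 - crd2 (diamond x y) * crd1 z != 0 ->
  diamond x (diamond y z) = diamond (diamond x y) z.
Proof.
rewrite crd2_diamond => xy_neq0 yz_neq0 xyz_neq0.
have d_neq0 : (1 - crd2 x * crd1 y) -
    (crd2 y - crd2 x * crd3 y) * crd1 z != 0.
  have -> : 1 - crd2 x * crd1 y - (crd2 y - crd2 x * crd3 y) * crd1 z =
      (1 - crd2 x * crd1 y) * (1 - (crd2 y - crd2 x * crd3 y) /
        (1 - crd2 x * crd1 y) * crd1 z) by field.
  exact: mulf_neq0.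
have d_neq0' : (1 - crd2 y * crd1 z) -
    crd2 x * (crd1 y - crd3 y * crd1 z) != 0.
  by rewrite (_ : _ - _ = (1 - crd2 x * crd1 y) -
    (crd2 y - crd2 x * crd3 y) * crd1 z) //; ring.
by apply: crd_inj; rewrite !crdE; field; do ?[apply/andP; split].
Qed.

(* The action of the matrix M_x on the Riemann sphere. *)
Definition mobius x w := (crd1 x - crd3 x * w) / (1 - crd2 x * w).

Lemma mobius_diamond x y w : 1 - crd2 x * crd1 y != 0 ->
    1 - crd2 y * w != 0 -> 1 - crd2 x * mobius y w != 0 ->
  1 - crd2 (diamond x y) * w != 0 /\
  mobius (diamond x y) w = mobius x (mobius y w).
Proof.
rewrite /mobius !crdE => xy_neq0 yw_neq0 xyw_neq0.
have e : (1 - crd2 y * w) *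
    (1 - crd2 x * ((crd1 y - crd3 y * w) / (1 - crd2 y * w))) =
    1 - crd2 x * crd1 y - (crd2 y - crd2 x * crd3 y) * w by field.
have d_neq0 : 1 - crd2 x * crd1 y - (crd2 y - crd2 x * crd3 y) * w != 0.
  by rewrite -e mulf_neq0.
have d_neq0' : 1 - crd2 y * w - crd2 x * (crd1 y - crd3 y * w) != 0.
  by rewrite (_ : _ - _ = 1 - crd2 x * crd1 y -
    (crd2 y - crd2 x * crd3 y) * w) //; ring.
split; last by field; do ?[apply/andP; split].
rewrite (_ : 1 - _ = (1 - crd2 x * crd1 y -
    (crd2 y - crd2 x * crd3 y) * w) / (1 - crd2 x * crd1 y)); last by field.
by rewrite mulf_neq0 ?invr_eq0.
Qed.

(** The Schwarz-Pick identity: the cross terms of the two squares cancel. The signs of the factors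
    then control the modulus of a Blaschke factor. *)
Lemma norm_pick a w : `|1 - a * w| ^+ 2 - `|a^* - w| ^+ 2 =
  (1 - `|a| ^+ 2) * (1 - `|w| ^+ 2).
Proof. by rewrite !normCK !rmorphB rmorphM rmorph1 /= conjCK; ring. Qed.

Lemma mul1B_neq0 a w : `|a| < 1 -> `|w| <= 1 -> 1 - a * w != 0.
Proof.
move=> a1 w1; rewrite subr_eq0; apply/eqP => e.
suff : `|a * w| < 1 by rewrite -e normr1 ltxx.
by rewrite normrM (le_lt_trans _ a1) // ler_piMr.
Qed.

Lemma norm_pick_le a w : `|a| <= 1 -> `|w| <= 1 -> `|a^* - w| <= `|1 - a * w|.
Proof.
move=> a1 w1; rewrite -(@ler_pXn2r _ 2) ?nnegrE // -subr_ge0 norm_pick.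
by rewrite mulr_ge0 // subr_ge0 expr_le1.
Qed.

Lemma norm_pick_lt a w : `|a| < 1 -> `|w| < 1 -> `|a^* - w| < `|1 - a * w|.
Proof.
move=> a1 w1; rewrite -(@ltr_pXn2r _ 2) ?nnegrE // -subr_gt0 norm_pick.
by rewrite mulr_gt0 // subr_gt0 expr_lt1.
Qed.

(** The order on [R[i]] is only partial; norms can be compared because they are real. *)
Lemma norm_not_lt a b : ~~ (`|a| < `|b|) -> `|b| <= `|a|.
Proof. by rewrite -real_leNgt ?normr_real. Qed.

(** The defining polynomial is affine in z, namely (1 - x_2 w) - z (x_1 - x_3 w), so its root in z
    is the reciprocal of [mobius x w]. *)
Lemma tetrablockP x : tetrablock R x <->
  forall w, `|w| <= 1 -> 1 - crd2 x * w != 0 /\ `|mobius x w| < 1.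
Proof.
split=> [Ex w w1 | Ex w z w1 z1]; last first.
  have [d_neq0] := Ex _ z1; rewrite normrM normfV.
  rewrite ltr_pdivrMr ?normr_gt0 // mul1r => lt_xw; rewrite (_ : _ + _ =
    1 - crd2 x * z - w * (crd1 x - crd3 x * z)); last by ring.
  rewrite subr_eq0; apply/eqP => e; have : `|w * (crd1 x - crd3 x * z)| <=
    `|crd1 x - crd3 x * z| by rewrite normrM ler_piMl.
  by rewrite -e => /(lt_le_trans lt_xw); rewrite ltxx.
have d_neq0 : 1 - crd2 x * w != 0.
  by have := Ex 0 w; rewrite normr0 ler01 w1 !mulr0 mul0r addr0 subr0; exact.
split=> //; rewrite normrM normfV ltr_pdivrMr ?normr_gt0 // mul1r.
apply/negPn/negP => /norm_not_lt le_wx.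
have n_neq0 : crd1 x - crd3 x * w != 0.
  by rewrite -normr_gt0 (lt_le_trans _ le_wx) // normr_gt0.
(* This root lies in the closed disc as soon as the modulus of [mobius x w] is at least 1. *)
have := Ex ((1 - crd2 x * w) / (crd1 x - crd3 x * w)) w.
rewrite normrM normfV ler_pdivrMr ?normr_gt0 // mul1r => /(_ le_wx w1)/eqP.
by apply; field.
Qed.

(** The non-strict form of [tetrablockP]. It covers both points of the tetrablock and parameter
    vectors, so denominators in mixed products are handled uniformly. *)
Definition contractive x :=
  forall w, `|w| <= 1 -> 1 - crd2 x * w != 0 /\ `|mobius x w| <= 1.

Lemma tetrablock_contractive x : tetrablock R x -> contractive x.
Proof. by move=> /tetrablockP Ex w /Ex[? /ltW]. Qed.

Lemma contractive_crd1 x : contractive x -> `|crd1 x| <= 1.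
Proof.
by move/(_ 0); rewrite normr0 /mobius !mulr0 !subr0 divr1 => /(_ ler01)[].
Qed.

(** [crd1 y] is [mobius y 0], hence a point of the closed disc, where the denominator of [mobius x]
    does not vanish. *)
Lemma contractive_neq0 x y : contractive x -> contractive y ->
  1 - crd2 x * crd1 y != 0.
Proof. by move=> cx /contractive_crd1/cx[]. Qed.

Lemma contractive_mobius_diamond x y w : contractive x -> contractive y ->
    `|w| <= 1 ->
  1 - crd2 (diamond x y) * w != 0 /\
  mobius (diamond x y) w = mobius x (mobius y w).
Proof.
move=> cx cy w1; have [yw_neq0 yw1] := cy _ w1; have [xyw_neq0 _] := cx _ yw1.
exact: mobius_diamond (contractive_neq0 cx cy) yw_neq0 xyw_neq0.
Qed.

Lemma contractive_diamond x y :
  contractive x -> contractive y -> contractive (diamond x y).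
Proof.
move=> cx cy w w1; have [? ->] := contractive_mobius_diamond cx cy w1.
by split=> //; have [_ /cx[]] := cy _ w1.
Qed.

Lemma contractive_diamondA x y z :
    contractive x -> contractive y -> contractive z ->
  diamond x (diamond y z) = diamond (diamond x y) z.
Proof.
move=> cx cy cz; apply: diamondA; apply: contractive_neq0 => //.
exact: contractive_diamond.
Qed.

(** The inner map [mobius y] keeps the closed disc, and the outer map [mobius x] sends it into the
    open disc. *)
Lemma tetrablock_diamond_contractive x y :
  tetrablock R x -> contractive y -> tetrablock R (diamond x y).
Proof.
move=> Ex cy; apply/tetrablockP => w w1; have cx := tetrablock_contractive Ex.
have [? ->] := contractive_mobius_diamond cx cy w1.
by split=> //; have [_ yw1] := cy _ w1; have [] := (tetrablockP x).1 Ex _ yw1.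
Qed.

Lemma tetrablock_flip x : tetrablock R x -> tetrablock R (flip x).
Proof.
move=> Ex z w z1 w1; have := Ex _ _ w1 z1; rewrite !crdE.
by rewrite -[_ - _ - crd2 x * z]addrAC -mulrA [w * z]mulrC mulrA.
Qed.

(* The parameter vectors of disc automorphisms: [t] = tau(upsilon) for
   upsilon = [mobius t], with alpha = [(crd2 t)^*] and omega = [crd3 t]. *)
Definition disc_param t :=
  [/\ `|crd3 t| = 1, `|crd2 t| < 1 & crd1 t = crd3 t * (crd2 t)^*].

Lemma unimodularV a : `|a| = 1 -> a * a^* = 1.
Proof. by move=> a1; rewrite -normCK a1 expr1n. Qed.

Lemma mobius_disc_param t w : disc_param t ->
  mobius t w = crd3 t * ((crd2 t)^* - w) / (1 - crd2 t * w).
Proof. by case=> _ _ e; rewrite /mobius e mulrBr. Qed.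

Lemma disc_param_contractive t : disc_param t -> contractive t.
Proof.
move=> pt w w1; have [t3 t2 _] := pt; have d_neq0 := mul1B_neq0 t2 w1.
split=> //; rewrite mobius_disc_param // normf_div normrM t3 mul1r.
by rewrite ler_pdivrMr ?normr_gt0 // mul1r norm_pick_le // ltW.
Qed.

Lemma mobius_disc_param_lt t w : disc_param t -> `|w| < 1 -> `|mobius t w| < 1.
Proof.
move=> pt w1; have [t3 t2 _] := pt; have d_neq0 := mul1B_neq0 t2 (ltW w1).
rewrite mobius_disc_param // normf_div normrM t3 mul1r.
by rewrite ltr_pdivrMr ?normr_gt0 // mul1r norm_pick_lt.
Qed.

Lemma disc_param_flip t : disc_param t -> disc_param (flip t).
Proof.
case=> t3 t2 e; split; rewrite !crdE //.
  by rewrite e normrM t3 mul1r norm_conjC.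
by rewrite e rmorphM /= conjCK mulrA unimodularV ?mul1r.
Qed.

Lemma disc_param_diamond s t :
  disc_param s -> disc_param t -> disc_param (diamond s t).
Proof.
move=> ps pt; have d_neq0 :=
  contractive_neq0 (disc_param_contractive ps) (disc_param_contractive pt).
case: ps pt d_neq0 => [s3 s2 es] [t3 t2 et] d_neq0.
(* The third coordinate is thus a unimodular number times the conjugate of the denominator over the
   denominator. *)
have e3 : crd1 s * crd2 t - crd3 s * crd3 t =
    - (crd3 s * crd3 t) * (1 - crd2 s * crd1 t)^*.
  rewrite et es rmorphB !rmorphM rmorph1 /= conjCK.
  have -> : - (crd3 s * crd3 t) *
      (1 - (crd2 s)^* * ((crd3 t)^* * crd2 t)) = - (crd3 s * crd3 t) +
    crd3 t * (crd3 t)^* * (crd3 s * (crd2 s)^* * crd2 t) by ring.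
  by rewrite unimodularV // mul1r addrC.
split; rewrite !crdE.
- rewrite e3 normf_div normrM normrN normrM s3 t3 norm_conjC !mul1r divff //.
  by rewrite normr_eq0.
- rewrite normf_div ltr_pdivrMr ?normr_gt0 // mul1r et.
  rewrite (_ : crd2 s * (_ * _) = (crd2 t)^* * (crd2 s * crd3 t)); last by ring.
  rewrite -[X in `|X - _|]conjCK norm_pick_lt ?norm_conjC //.
  by rewrite normrM t3 mulr1.
- set d := 1 - _ in e3 d_neq0 *; have dJ_neq0 : d^* != 0 by rewrite conjC_eq0.
  clearbody d; rewrite e3 rmorphM fmorphV rmorphB rmorphM /= es et.
  (* The relation of unimodularity is isolated in a summand that vanishes; what remains is a pure
     field identity. *)
  have -> : (crd3 s * (crd2 s)^* - crd3 s * (crd3 t * (crd2 t)^*)) =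
    - (crd3 s * crd3 t) * ((crd2 t)^* - (crd2 s)^* * (crd3 t)^*) +
    (1 - crd3 t * (crd3 t)^*) * (crd3 s * (crd2 s)^*) by ring.
  rewrite unimodularV // subrr mul0r addr0.
  by field; rewrite ?dJ_neq0 ?d_neq0.
Qed.

(** The matrix is minus the identity: alpha = 0 gives -omega z, so the identity of the disc has
    omega = -1. *)
Definition disc_param_id : C3 := vec3 0 0 (- 1).

(** On parameter vectors this is the adjugate of M_t divided by -t_3, rewritten with |t_3| = 1 and
    t_1 = t_3 (t_2)^*. *)
Definition disc_param_inv t : C3 :=
  vec3 (crd2 t)^* (crd1 t)^* (crd3 t)^*.

Lemma flip_disc_param_id : flip disc_param_id = disc_param_id.
Proof. by rewrite /flip !crdE. Qed.

Lemma diamond_idl x : diamond disc_param_id x = x.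
Proof.
by apply: crd_inj; rewrite !crdE !mul0r ?mulN1r ?sub0r ?opprK ?subr0 ?divr1 //;
   ring.
Qed.

Lemma diamond_idr x : diamond x disc_param_id = x.
Proof.
rewrite -[RHS]flipK -(diamond_idl (flip x)) flip_diamond flipK.
by rewrite flip_disc_param_id.
Qed.

Lemma disc_param_idP : disc_param disc_param_id.
Proof. by split; rewrite !crdE ?normrN1 ?normr0 // rmorph0 mulr0. Qed.

Lemma disc_param_norm_crd1 t : disc_param t -> `|crd1 t| = `|crd2 t|.
Proof. by case=> t3 _ ->; rewrite normrM t3 mul1r norm_conjC. Qed.

Lemma disc_param_invP t : disc_param t -> disc_param (disc_param_inv t).
Proof.
move=> pt; have e1 := disc_param_norm_crd1 pt; case: pt => t3 t2 e.
split; rewrite !crdE ?norm_conjC ?e1 // conjCK e mulrA [_^* * _]mulrC.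
by rewrite unimodularV ?mul1r.
Qed.

Lemma disc_param_invK : involutive disc_param_inv.
Proof. by move=> t; apply: crd_inj; rewrite !crdE conjCK. Qed.

Lemma diamond_invl t : disc_param t ->
  diamond (disc_param_inv t) t = disc_param_id.
Proof.
move=> pt; have pV := disc_param_invP pt.
have := contractive_neq0 (disc_param_contractive pV)
  (disc_param_contractive pt).
case: pt => t3 t2 e; have t3K : (crd3 t)^* * crd3 t = 1.
  by rewrite mulrC unimodularV.
have e2 : (crd3 t)^* * crd1 t = (crd2 t)^* by rewrite e mulrA t3K mul1r.
have e3 : (crd1 t)^* * crd3 t = crd2 t.
  by rewrite e rmorphM /= conjCK mulrAC t3K mul1r.
rewrite !crdE => d_neq0; apply: crd_inj; rewrite !crdE.
- by rewrite e2 subrr mul0r.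
- by rewrite e3 subrr mul0r.
have e4 : (crd1 t)^* * crd1 t = (crd2 t)^* * crd2 t.
  by rewrite {2}e mulrA e3 mulrC.
rewrite e4 t3K in d_neq0 *.
by rewrite -[_ - 1]opprB mulNr divff.
Qed.

Lemma diamond_invr t : disc_param t ->
  diamond t (disc_param_inv t) = disc_param_id.
Proof.
by move=> /disc_param_invP /diamond_invl; rewrite disc_param_invK.
Qed.

Lemma tetrablock_diamondr x t :
  tetrablock R x -> disc_param t -> tetrablock R (diamond x t).
Proof.
by move=> Ex /disc_param_contractive; apply: tetrablock_diamond_contractive.
Qed.

(** The flip reverses the product and moves the parameter vector to the right. *)
Lemma tetrablock_diamondl x t :
  tetrablock R x -> disc_param t -> tetrablock R (diamond t x).
Proof.
move=> Ex pt; rewrite -[diamond t x]flipK flip_diamond; apply: tetrablock_flip.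
by apply: tetrablock_diamondr; [exact: tetrablock_flip|exact: disc_param_flip].
Qed.

Lemma tetrablock_iter_flip n x :
  tetrablock R x -> tetrablock R (iter n (@flip R) x).
Proof. by move=> Ex; elim: n => //= n; apply: tetrablock_flip. Qed.

End Algebra.

(** * Openness of the tetrablock *)

Section Openness.
Variable R : realType.
Local Notation C := R[i].
Local Notation C3 := 'rV[R[i]]_3.
Local Notation V3 := ('rV[R[i]]_3 : normedModType R[i]).
Implicit Types (x y : C3) (a b w : C).

Lemma unimodular_factor a : exists2 u, `|u| = 1 & a = `|a| * u.
Proof.
have [->|a_neq0] := eqVneq a 0.
  by exists 1; rewrite ?normr1 // normr0 mul0r.
exists (a / `|a|); first by rewrite normf_div normr_id divff ?normr_eq0.
by rewrite mulrC divfK ?normr_eq0.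
Qed.

(* If [`|crd2 x| < 1], then [mobius x] maps the closed unit disc onto the closed
   disc of centre
   [(crd1 x - (crd2 x)^* * crd3 x) / (1 - `|crd2 x| ^+ 2)] and radius
   [`|crd1 x * crd2 x - crd3 x| / (1 - `|crd2 x| ^+ 2)]. *)
Definition tetrablock_gauge x :=
  `|crd1 x - (crd2 x)^* * crd3 x| + `|crd1 x * crd2 x - crd3 x| +
  `|crd2 x| ^+ 2.

(** With denominators cleared: [mobius x w] is the centre minus a number of modulus the radius times
    a Blaschke factor. *)
Lemma mobius_center_radius x w :
  (crd1 x - crd3 x * w) * (1 - `|crd2 x| ^+ 2) =
  (crd1 x - (crd2 x)^* * crd3 x) * (1 - crd2 x * w) -
  (crd1 x * crd2 x - crd3 x) * ((crd2 x)^* - w).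
Proof. by rewrite normCK; ring. Qed.

(** A closed disc lies in the open unit disc iff the modulus of its centre plus its radius is below
    1; the gauge clears the denominator 1 - |x_2|^2. *)
Lemma tetrablock_gaugeP x : tetrablock R x <-> tetrablock_gauge x < 1.
Proof.
rewrite /tetrablock_gauge; set c := crd1 x - _; set d := crd1 x * _ - _.
split=> [Ex | lt1].
  (* Otherwise z = 0 and w = 1 / x_2 give a forbidden zero. *)
  have x2_lt1 : `|crd2 x| < 1.
    apply/negPn/negP; rewrite -[1]normr1 => /norm_not_lt.
    rewrite normr1 => x2_ge1.
    have x2_neq0 : crd2 x != 0 by rewrite -normr_gt0 (lt_le_trans ltr01).
    have := Ex 0 (crd2 x)^-1.
    rewrite normr0 ler01 normfV invf_le1 ?normr_gt0 //.
    by rewrite mulfV // !mulr0 mul0r subr0 addr0 subrr eqxx => /(_ isT x2_ge1).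
  have s_gt0 : 0 < 1 - `|crd2 x| ^+ 2 by rewrite subr_gt0 expr_lt1.
  have [u u1 cE] := unimodular_factor c; have [v v1 dE] := unimodular_factor d.
  have e1 : `|u * v^*| = 1 by rewrite normrM norm_conjC u1 v1 mulr1.
  set e := u * v^* in e1.
  (* [w] is chosen so that [w - (crd2 x)^*] is [e * (1 - crd2 x * w)]; this
     aligns the two terms of [mobius_center_radius]. *)
  have d_neq0 : 1 + crd2 x * e != 0.
    by rewrite -[crd2 x * e]opprK -mulrN mul1B_neq0 // normrN e1.
  pose w := (e + (crd2 x)^*) / (1 + crd2 x * e).
  have w1 : `|w| <= 1.
    rewrite normf_div ler_pdivrMr ?normr_gt0 // mul1r addrC -[e]opprK mulrN.
    by rewrite norm_pick_le ?normrN ?e1 ?(ltW x2_lt1).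
  have [xw_neq0] := (tetrablockP x).1 Ex _ w1.
  rewrite normf_div ltr_pdivrMr ?normr_gt0 // mul1r => lt_xw.
  have wE : (crd2 x)^* - w = - (e * (1 - crd2 x * w)) by rewrite /w; field.
  have := mobius_center_radius x w; rewrite -/c -/d wE.
  have -> : c * (1 - crd2 x * w) - d * - (e * (1 - crd2 x * w)) =
    (`|c| + `|d|) * (u * (1 - crd2 x * w)).
    rewrite {1}cE {1}dE /e.
    have -> : `|c| * u * (1 - crd2 x * w) -
        `|d| * v * - (u * v^* * (1 - crd2 x * w)) =
       (`|c| + `|d| * (v * v^*)) * (u * (1 - crd2 x * w)) by ring.
    by rewrite unimodularV // mulr1.
  move=> /(congr1 Num.norm); rewrite !normrM u1 mul1r.
  rewrite (gtr0_norm s_gt0) (ger0_norm (addr_ge0 (normr_ge0 c) (normr_ge0 d))).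
  move=> eq_xw.
  rewrite -ltrBrDr -(@ltr_pM2r _ `|1 - crd2 x * w|) ?normr_gt0 // -eq_xw.
  by rewrite [ltRHS]mulrC ltr_pM2r.
apply/tetrablockP => w w1.
have x2_lt1 : `|crd2 x| < 1.
  rewrite -(@expr_lt1 _ 2) //; apply: le_lt_trans lt1.
  by rewrite lerDr addr_ge0.
have s_gt0 : 0 < 1 - `|crd2 x| ^+ 2 by rewrite subr_gt0 expr_lt1.
have xw_neq0 := mul1B_neq0 x2_lt1 w1; split=> //.
rewrite normf_div ltr_pdivrMr ?normr_gt0 // mul1r -(ltr_pM2r s_gt0).
rewrite -{1}(gtr0_norm s_gt0) -normrM mobius_center_radius -/c -/d.
apply: (@le_lt_trans _ _ ((`|c| + `|d|) * `|1 - crd2 x * w|)).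
  rewrite (le_trans (ler_normB _ _)) // !normrM mulrDl lerD2l ler_wpM2l //.
  by rewrite norm_pick_le // ltW.
by rewrite [ltRHS]mulrC ltr_pM2r ?normr_gt0 // ltrBrDr.
Qed.

Lemma isometry_continuous (K : numFieldType) (V W : normedModType K)
    (f : V -> W) :
  (forall u v, `|f u - f v| = `|u - v|) -> continuous f.
Proof.
move=> f_iso u; apply/cvgrPdist_lt => e e0; near=> v.
by rewrite f_iso; near: v; exact: cvgr_dist_lt.
Unshelve. all: by end_near. Qed.

Lemma conjC_continuous : continuous (fun w : C^o => w^* : C^o).
Proof.
apply: isometry_continuous.
by move=> w z; rewrite -rmorphB norm_conjC.
Qed.

Lemma continuous_gauge (K : numFieldType) (T : topologicalType)
    (a b c d : T -> K) :
  continuous a -> continuous b -> continuous c -> continuous d ->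
  continuous (fun u => `|a u - c u * d u| + `|a u * b u - d u| + `|b u| ^+ 2).
Proof.
move=> ca cb cc cd u; apply: cvgD; first apply: cvgD.
- apply: cvg_norm; apply: cvgB; first exact: ca.
  by apply: cvgM; [exact: cc|exact: cd].
- apply: cvg_norm; apply: cvgB; last exact: cd.
  by apply: cvgM; [exact: ca|exact: cb].
- by apply: cvgM; apply: cvg_norm; apply: cb.
Qed.

Lemma tetrablock_gauge_continuous : continuous (tetrablock_gauge : V3 -> C^o).
Proof.
have c1 : continuous (@crd1 R : V3 -> C^o) by move=> x; apply: coord_continuous.
have c2 : continuous (@crd2 R : V3 -> C^o) by move=> x; apply: coord_continuous.
have c3 : continuous (@crd3 R : V3 -> C^o) by move=> x; apply: coord_continuous.
have c2J : continuous (fun x : V3 => (crd2 x)^* : C^o).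
  by move=> x; apply: (continuous_comp (c2 x)); exact: conjC_continuous.
exact: (continuous_gauge c1 c2 c2J c3).
Qed.

Lemma near_dist_lt (K : numFieldType) (T : topologicalType) (f : T -> K) u e :
  continuous f -> 0 < e -> \forall v \near u, `|f v - f u| < e.
Proof. by move=> cf; apply: cvgr_distC_lt; apply: cf. Qed.

Lemma tetrablock_nbhs (x : V3) : tetrablock R x -> \near x, tetrablock R x.
Proof.
move=> /tetrablock_gaugeP; rewrite -subr_gt0 => gap_gt0.
have := near_dist_lt x tetrablock_gauge_continuous gap_gt0.
apply: filterS => y lt_yx; apply/tetrablock_gaugeP.
(* In the partial order of [R[i]], a number is bounded by its norm only when it is real. *)
have y_real : tetrablock_gauge y - tetrablock_gauge x \is Num.real.
  by rewrite rpredB // !rpredD ?rpredX ?normr_real.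
by have := le_lt_trans (real_ler_norm y_real) lt_yx; rewrite ltrD2r.
Qed.

End Openness.

(** * Complex differentiability *)

Section Differentiability.
Variable R : realType.
Local Notation C := R[i].
Local Notation C3 := 'rV[R[i]]_3.

(** The first-order expansion of [f] serves for [g], and uniqueness of the differential identifies
    ['d g x]. Members of [LRF_maps] are prescribed on the tetrablock only, so they are compared with
    [lrf] this way. *)
Lemma near_eq_differentiable (K : numFieldType) (V W : normedModType K)
    (f g : V -> W) (x : V) :
  (\near x, f x = g x) -> differentiable f x -> differentiable g x.
Proof.
move=> eq_fg df; have [df_cont /eqaddoP df_o] := (diff_locallyP _ _).1 df.
have dg_o : g \o shift x = cst (g x) + 'd f x +o_ 0 id.
  apply/eqaddoP => e e0; rewrite -(nbhs_singleton eq_fg).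
  have : \forall h \near (0 : V), f (h + x) = g (h + x).
    by move: eq_fg; rewrite (near_shift 0) subr0.
  by apply: filterS2 (df_o e e0) => h; rewrite !fctE /= => + <-.
have dgE : 'd g x = 'd f x :> (V -> W) by apply: diff_unique.
by apply/diff_locallyP; rewrite dgE.
Qed.

Context {V : normedModType C}.

Lemma differentiable_vec3 (f1 f2 f3 : V -> C^o) x :
    differentiable f1 x -> differentiable f2 x -> differentiable f3 x ->
  differentiable (fun y => vec3 (f1 y) (f2 y) (f3 y)) x.
Proof.
move=> df1 df2 df3.
have -> : (fun y => vec3 (f1 y) (f2 y) (f3 y)) =
    (fun y => f1 y *: vec3 1 0 0) + (fun y => f2 y *: vec3 0 1 0) +
    (fun y => f3 y *: vec3 0 0 1).
  apply/funext => y; rewrite !fctE; apply: crd_inj;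
  by rewrite crdE /crd1 /crd2 /crd3 !mxE /= !mulr0 !mulr1 ?addr0 ?add0r.
by do ?apply: differentiableD; apply: differentiableZl.
Qed.

Lemma differentiable_crd (i : 'I_3) (f : V -> C3) x :
  differentiable f x -> differentiable (fun y => f y 0 i : C^o) x.
Proof.
by move=> df; apply: differentiable_comp df (differentiable_coord _ _ _).
Qed.

Lemma differentiable_flip (f : V -> C3) x :
  differentiable f x -> differentiable (fun y => flip (f y)) x.
Proof. by move=> df; apply: differentiable_vec3; apply: differentiable_crd. Qed.

Lemma differentiable_iter_flip n (f : V -> C3) x :
  differentiable f x -> differentiable (fun y => iter n (@flip R) (f y)) x.
Proof. by move=> df; elim: n => //= n; apply: differentiable_flip. Qed.

Lemma differentiable_diamond (f g : V -> C3) x :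
    1 - crd2 (f x) * crd1 (g x) != 0 ->
    differentiable f x -> differentiable g x ->
  differentiable (fun y => diamond (f y) (g y)) x.
Proof.
move=> d_neq0 df dg.
have crdf i : differentiable (fun y => f y 0 i : C^o) x.
  exact: differentiable_crd.
have crdg i : differentiable (fun y => g y 0 i : C^o) x.
  exact: differentiable_crd.
pose k y : C^o := (1 - crd2 (f y) * crd1 (g y))^-1.
have dk : differentiable k x.
  exact: (differentiableV (differentiableB (differentiable_cst _ _)
    (differentiableM (crdf 1) (crdg 0))) d_neq0).
have -> : (fun y => diamond (f y) (g y)) = (fun y => vec3
    (k y * (crd1 (f y) - crd3 (f y) * crd1 (g y)))
    (k y * (crd2 (g y) - crd2 (f y) * crd3 (g y)))
    (k y * (crd1 (f y) * crd2 (g y) - crd3 (f y) * crd3 (g y)))).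
  by apply/funext => y; apply: crd_inj; rewrite !crdE mulrC.
apply: differentiable_vec3.
- exact: (differentiableM dk (differentiableB (crdf 0)
    (differentiableM (crdf 2%:R) (crdg 0)))).
- exact: (differentiableM dk (differentiableB (crdg 1)
    (differentiableM (crdf 1) (crdg 2%:R)))).
- exact: (differentiableM dk (differentiableB
    (differentiableM (crdf 0) (crdg 1))
    (differentiableM (crdf 2%:R) (crdg 2%:R)))).
Qed.

End Differentiability.

(** * The group law *)

Section Group.
Variable R : realType.
Local Notation C := R[i].
Local Notation C3 := 'rV[R[i]]_3.
Implicit Types (x y s t : C3) (f g : C3 -> C3) (b c : bool).

Lemma mobius_disc_paramK t w : disc_param t -> `|w| <= 1 ->
  mobius (disc_param_inv t) (mobius t w) = w.
Proof.
move=> pt w1; have pV := disc_param_invP pt.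
have [_ <-] := contractive_mobius_diamond (disc_param_contractive pV)
  (disc_param_contractive pt) w1.
by rewrite diamond_invl // /mobius !crdE mul0r subr0 divr1 sub0r mulN1r opprK.
Qed.

Lemma differentiable_mobius t (w : C^o) : disc_param t -> `|w| < 1 ->
  differentiable (mobius t : C^o -> C^o) w.
Proof.
move=> [_ t2 _] w1.
have dM (a b : C) : differentiable ((fun z => a - b * z) : C^o -> C^o) w.
  by apply: differentiableB => //; apply: differentiableM.
apply: (differentiableM (dM _ _)); apply: (differentiableV (dM _ _)).
by rewrite mul1B_neq0 // ltW.
Qed.

(** [LRF_maps] quantifies over automorphisms of the disc; this supplies one for each parameter
    vector. *)
Lemma mobius_Aut t : disc_param t ->
  Aut (unit_disc R) (mobius t : C^o -> C^o).
Proof.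
move=> pt; have pV := disc_param_invP pt.
split; first by move=> w; apply: mobius_disc_param_lt.
split; first by move=> w; apply: differentiable_mobius.
exists (mobius (disc_param_inv t)); split=> [w|w|w /ltW|w /ltW].
- exact: mobius_disc_param_lt.
- exact: differentiable_mobius.
- exact: mobius_disc_paramK.
- by rewrite -{1}[t]disc_param_invK; apply: mobius_disc_paramK.
Qed.

Lemma is_tau_mobius t : disc_param t -> is_tau (mobius t) t.
Proof.
move=> pt; have [t3 t2 e] := pt; exists (crd2 t)^*, (crd3 t); split=> //.
- by rewrite norm_conjC.
- move=> w w1; rewrite mobius_disc_param // conjCK -mulrA; congr (_ * _).
  by rewrite -[RHS]mulrNN -invrN !opprB.
- by rewrite conjCK; apply: crd_inj; rewrite !crdE.
Qed.

Lemma is_tau_disc_param upsilon t : is_tau upsilon t -> disc_param t.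
Proof.
by move=> [a [u [a1 u1 _ ->]]]; split; rewrite !crdE ?norm_conjC ?conjCK.
Qed.

(** Normal form of the elements of the group; with a boolean exponent, the flips add up by [(+)]. *)
Definition lrf s t b x := diamond s (diamond (iter b (@flip R) x) t).

Lemma LRF_mapsP f : LRF_maps R f <->
  exists s t b, [/\ disc_param s, disc_param t &
    forall x, tetrablock R x -> f x = lrf s t b x].
Proof.
split=> [|[s [t [b [ps pt fE]]]]].
  move=> [upsilon [chi [nu [_ _ nuE [l [r [[s ts lE] [t tt rE] fE]]]]]]].
  exists s, t, (nu == 1)%N; split; [exact: is_tau_disc_param ts|
    exact: is_tau_disc_param tt|move=> x Ex].
  have Ex' := tetrablock_iter_flip nu Ex.
  rewrite /lrf; have -> : ((nu == 1) = nu :> nat)%N by case: nuE => ->.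
  rewrite fE // rE // lE //; apply: tetrablock_diamondr => //.
  exact: is_tau_disc_param tt.
exists (mobius s), (mobius t), b; split; [exact: mobius_Aut|exact: mobius_Aut|
  by case: b {fE}; [right|left]|].
exists (@diamond R s), (fun x => diamond x t); split=> //.
  by exists s => //; apply: is_tau_mobius.
by exists t => //; apply: is_tau_mobius.
Qed.

Lemma tetrablock_lrf s t b x : disc_param s -> disc_param t ->
  tetrablock R x -> tetrablock R (lrf s t b x).
Proof.
move=> ps pt Ex; apply: tetrablock_diamondl ps; apply: tetrablock_diamondr pt.
exact: tetrablock_iter_flip.
Qed.

Lemma contractive_diamondACA s t s' t' x : contractive s -> contractive t ->
    contractive s' -> contractive t' -> contractive x ->
  diamond s (diamond (diamond s' (diamond x t')) t) =
  diamond (diamond s s') (diamond x (diamond t' t)).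
Proof.
move=> cs ct cs' ct' cx.
by rewrite -!contractive_diamondA //; do ?apply: contractive_diamond.
Qed.

(** A semidirect product law: left and right multiplications commute by associativity, and moving a
    flip past them swaps and flips [s'] and [t']. *)
Lemma lrf_comp s t b s' t' c x : disc_param s -> disc_param t ->
    disc_param s' -> disc_param t' -> tetrablock R x ->
  lrf s t b (lrf s' t' c x) =
  lrf (diamond s (if b then flip t' else s'))
      (diamond (if b then flip s' else t') t) (b (+) c) x.
Proof.
move=> ps pt ps' pt' Ex; rewrite /lrf.
have [cs ct] := (disc_param_contractive ps, disc_param_contractive pt).
have Ey := tetrablock_iter_flip c Ex.
case: b => /=; last first.
  exact: (contractive_diamondACA cs ct (disc_param_contractive ps')
    (disc_param_contractive pt') (tetrablock_contractive Ey)).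
have -> : iter (~~ c) (@flip R) x = flip (iter c (@flip R) x).
  by case: c {Ey} => //=; rewrite flipK.
set y := iter c _ x in Ey *.
have cy := tetrablock_contractive (tetrablock_flip Ey).
have cfs := disc_param_contractive (disc_param_flip ps').
have cft := disc_param_contractive (disc_param_flip pt').
rewrite (flip_diamond s' (diamond y t')) (flip_diamond y t').
rewrite -(contractive_diamondA cft cy cfs).
exact: contractive_diamondACA.
Qed.

Lemma lrf_id x : lrf (disc_param_id R) (disc_param_id R) false x = x.
Proof. by rewrite /lrf /= diamond_idl diamond_idr. Qed.

Lemma lrf_inverse s t b : disc_param s -> disc_param t ->
  exists s' t', [/\ disc_param s', disc_param t' &
    forall x, tetrablock R x ->
      lrf s' t' b (lrf s t b x) = x /\ lrf s t b (lrf s' t' b x) = x].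
Proof.
move=> ps pt; pose s' := disc_param_inv s; pose t' := disc_param_inv t.
have ps' : disc_param s' := disc_param_invP ps.
have pt' : disc_param t' := disc_param_invP pt.
have [pfs pft] := (disc_param_flip ps', disc_param_flip pt').
(* With a flip, the inverse F R_{t'} L_{s'} is brought to normal form as L_{F t'} R_{F s'} F. *)
exists (if b then flip t' else s'), (if b then flip s' else t').
split; [by case: b|by case: b|move=> x Ex].
rewrite !lrf_comp //; try by case: b.
rewrite addbb; case: b;
  rewrite ?flipK -?flip_diamond ?diamond_invl ?diamond_invr //.
  by rewrite flip_disc_param_id lrf_id.
by rewrite lrf_id.
Qed.

Lemma lrf_holomorphic s t b f : disc_param s -> disc_param t ->
    (forall x, tetrablock R x -> f x = lrf s t b x) ->
  holomorphic_on (tetrablock R) f.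
Proof.
move=> ps pt fE x Ex; apply: (@near_eq_differentiable _ _ _ (lrf s t b)).
  by near=> y; apply/esym/fE; near: y; exact: tetrablock_nbhs.
have Ex' := tetrablock_iter_flip b Ex.
have [cs ct] := (disc_param_contractive ps, disc_param_contractive pt).
have cx := tetrablock_contractive Ex'.
apply: differentiable_diamond => //.
  by apply: contractive_neq0 => //; apply: contractive_diamond.
apply: differentiable_diamond => //; first exact: contractive_neq0.
exact: differentiable_iter_flip.
Unshelve. all: by end_near. Qed.

Lemma lrf_Aut s t b f : disc_param s -> disc_param t ->
    (forall x, tetrablock R x -> f x = lrf s t b x) ->
  Aut (tetrablock R) f.
Proof.
move=> ps pt fE; have [s' [t' [ps' pt' gK]]] := lrf_inverse b ps pt.
split; first by move=> x Ex; rewrite fE //; apply: tetrablock_lrf.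
split; first exact: lrf_holomorphic fE.
exists (lrf s' t' b); split=> [x Ex||x Ex|x Ex].
- exact: tetrablock_lrf.
- exact: (lrf_holomorphic ps' pt').
- by rewrite fE //; have [] := gK _ Ex.
- by rewrite fE; [have [] := gK _ Ex|exact: tetrablock_lrf].
Qed.

End Group.

Theorem theorem6p4 (R : realType) :
  is_automorphism_group (tetrablock R) (LRF_maps R).
Proof.
split.
- by move=> f /LRF_mapsP[s [t [b [ps pt fE]]]]; apply: lrf_Aut fE.
- exists id => //; apply/LRF_mapsP.
  exists (disc_param_id R), (disc_param_id R), false.
  by split=> [||x _]; [exact: disc_param_idP
    |exact: disc_param_idP|rewrite lrf_id].
- move=> f g /LRF_mapsP[s [t [b [ps pt fE]]]].
  move=> /LRF_mapsP[s' [t' [c [ps' pt' gE]]]].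
  have [pfs pft] := (disc_param_flip ps', disc_param_flip pt').
  apply/LRF_mapsP; exists (diamond s (if b then flip t' else s')),
    (diamond (if b then flip s' else t') t), (b (+) c).
  split=> [||x Ex /=]; [by apply: disc_param_diamond => //; case: b {fE}
    |by apply: disc_param_diamond => //; case: b {fE}|].
  by rewrite gE // fE ?lrf_comp //; apply: tetrablock_lrf.
- move=> f /LRF_mapsP[s [t [b [ps pt fE]]]].
  have [s' [t' [ps' pt' gK]]] := lrf_inverse b ps pt.
  exists (lrf s' t' b); first by apply/LRF_mapsP; exists s', t', b.
  move=> x Ex; have [? ?] := gK _ Ex.
  by rewrite !fE //; apply: tetrablock_lrf.
Qed.
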